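(* Let $r,d,\bar P>0$, $0<A\le d^2$, $\xi=A/d^2$, $\theta\in(0,\pi)$ and $\phi\in(-\frac{\pi}{2},\frac{\pi}{2})$ be fixed. Let $\gamma=\gamma(M_y,M_z)$ be the closed-form SNR of the context with $L_y=M_yd$ and $L_z=M_zd$. Then $$\lim_{M_y,M_z\to\infty}\gamma(M_y,M_z)=\frac{\xi\bar P}{2}.$$
   Context: For a uniform planar array with $M_y\times M_z$ elements of area $A$ and spacing $d$, physical dimensions $L_y=M_yd$, $L_z=M_zd$, array occupation ratio $\xi=A/d^2\le1$ and transmit SNR $\bar P$, and a user at distance $r$ with zenith angle $\theta$ and azimuth angle $\phi$, put $\Psi=\sin\theta\cos\phi$, $\Phi=\sin\theta\sin\phi$, $\Omega=\cos\theta$. The closed-form SNR is $$\gamma=\frac{\xi\bar P}{4\pi}\left[U\!\left(\tfrac{L_y}{2r}-\Phi,\tfrac{L_z}{2r}-\Omega\right)+U\!\left(\tfrac{L_y}{2r}+\Phi,\tfrac{L_z}{2r}-\Omega\right)+U\!\left(\tfrac{L_y}{2r}-\Phi,\tfrac{L_z}{2r}+\Omega\right)+U\!\left(\tfrac{L_y}{2r}+\Phi,\tfrac{L_z}{2r}+\Omega\right)\right],$$ with $U(x,y)=\arctan\!\left(\dfrac{xy}{\Psi\sqrt{\Psi^2+x^2+y^2}}\right)$. *)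

(* Defs.v *)
From Stdlib Require Import Reals.
From Coquelicot Require Import Coquelicot.

Open Scope R_scope.

(* Direction cosines of the user, with zenith angle [theta] and azimuth [phi]. *)
Definition Psi (theta phi : R) : R := sin theta * cos phi.
Definition Phi (theta phi : R) : R := sin theta * sin phi.
Definition Omega (theta : R) : R := cos theta.

Definition occupation_ratio (A d : R) : R := A / d ^ 2.

Definition U (psi x y : R) : R :=
  atan (x * y / (psi * sqrt (psi ^ 2 + x ^ 2 + y ^ 2))).

(* Closed-form SNR of an [Ly] x [Lz] array with occupation ratio [xi] and
   transmit SNR [P], for a user at distance [r]. *)
Definition closed_form_snr (xi P r theta phi Ly Lz : R) : R :=
  let u := U (Psi theta phi) in
  let a := Ly / (2 * r) in
  let b := Lz / (2 * r) in
  xi * P / (4 * PI) *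
    (u (a - Phi theta phi) (b - Omega theta)
     + u (a + Phi theta phi) (b - Omega theta)
     + u (a - Phi theta phi) (b + Omega theta)
     + u (a + Phi theta phi) (b + Omega theta)).

(* [My] x [Mz] elements of area [A] with spacing [d]. *)
Definition gamma (A d P r theta phi : R) (My Mz : nat) : R :=
  closed_form_snr (occupation_ratio A d) P r theta phi (INR My * d) (INR Mz * d).

(* Main.v *)
Require Import Defs.
From Stdlib Require Import Reals Lra.
From Coquelicot Require Import Coquelicot.
Open Scope R_scope.

(** Both arguments of each of the four terms tend to infinity with the array,
    and [x * y / sqrt (psi ^ 2 + x ^ 2 + y ^ 2)] grows like [min x y], so each
    arctangent tends to [PI / 2], whatever the shifts [Phi] and [Omega]. *)

Lemma filterlim_atan_p_infty :
  filterlim atan (Rbar_locally p_infty) (locally (PI / 2)).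
Proof.
  apply filterlim_locally; intros eps.
  pose proof PI_RGT_0 as Hpi; pose proof (cond_pos eps) as Heps.
  (* The cap at [PI / 2] keeps [PI / 2 - delta] in [[0, PI / 2)], where [atan] inverts [tan]. *)
  set (delta := Rmin eps (PI / 2)).
  assert (Hdelta : 0 < delta) by (apply Rmin_glb_lt; lra).
  assert (Hdelta_eps : delta <= eps) by apply Rmin_l.
  assert (Hdelta_pi : delta <= PI / 2) by apply Rmin_r.
  exists (tan (PI / 2 - delta)); intros t Ht.
  apply atan_increasing in Ht.
  rewrite atan_tan in Ht by lra.
  pose proof (atan_bound t) as Hbound.
  change (Rabs (atan t - PI / 2) < eps).
  apply Rabs_def1; lra.
Qed.

Lemma sqrt_sum_squares_le (a b c : R) :
  0 <= a -> 0 <= b -> 0 <= c -> sqrt (a ^ 2 + b ^ 2 + c ^ 2) <= a + b + c.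
Proof.
  intros Ha Hb Hc.
  rewrite <- (sqrt_pow2 (a + b + c)) by lra.
  apply sqrt_le_1_alt; nra.
Qed.

(** Since [x + y >= 1], the root is at most [psi + x + y <= (psi + 1) * (x + y)]. As [m] lies below
    both [x] and [y], also [m * (x + y) < 2 * (x * y)]. Dividing leaves a bound linear in [m], with
    no relation between the sizes of [x] and [y]. *)
Lemma U_argument_lower_bound (psi m x y : R) :
  0 < psi -> 1 <= m -> m < x -> m < y ->
  m / (2 * (psi * (psi + 1))) < x * y / (psi * sqrt (psi ^ 2 + x ^ 2 + y ^ 2)).
Proof.
  intros Hpsi Hm Hx Hy.
  assert (Hle := sqrt_sum_squares_le psi x y ltac:(lra) ltac:(lra) ltac:(lra)).
  assert (Hpos : 0 < sqrt (psi ^ 2 + x ^ 2 + y ^ 2)) by (apply sqrt_lt_R0; nra).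
  set (s := sqrt (psi ^ 2 + x ^ 2 + y ^ 2)) in *.
  assert (Hs : s <= (psi + 1) * (x + y)) by nra.
  assert (Hxy : m * (x + y) < 2 * (x * y)) by nra.
  assert (Hms : m * s < (psi + 1) * (2 * (x * y))).
  { apply Rle_lt_trans with (m * ((psi + 1) * (x + y))).
    - apply Rmult_le_compat_l; lra.
    - replace (m * ((psi + 1) * (x + y))) with ((psi + 1) * (m * (x + y))) by ring.
      apply Rmult_lt_compat_l; lra. }
  apply -> Rlt_div_r; [|apply Rmult_lt_0_compat; lra].
  replace (m / (2 * (psi * (psi + 1))) * (psi * s))
    with (m * s / (2 * (psi + 1))) by (field; lra).
  apply <- Rlt_div_l; lra.
Qed.

Lemma filterlim_U_p_infty (psi : R) :
  0 < psi ->
  filterlim (fun p : R * R => U psi (fst p) (snd p))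
    (filter_prod (Rbar_locally p_infty) (Rbar_locally p_infty))
    (locally (PI / 2)).
Proof.
  intros Hpsi.
  apply (filterlim_comp _ _ _ _ atan _ (Rbar_locally p_infty));
    [|exact filterlim_atan_p_infty].
  intros P [K HK].
  set (c := 2 * (psi * (psi + 1))).
  assert (Hc : 0 < c) by (unfold c; nra).
  (* One threshold serves both coordinates: [K * c] makes the lower bound [m / c] at least [K], and
     [1] meets the condition under which that bound holds. *)
  set (m := Rmax 1 (K * c)).
  apply Filter_prod with (fun x => m < x) (fun y => m < y);
    [now exists m | now exists m |].
  intros x y Hx Hy; apply HK; simpl fst; simpl snd.
  apply Rle_lt_trans with (m / c).
  - apply -> Rle_div_r; [apply Rmax_r | assumption].
  - apply U_argument_lower_bound; trivial; apply Rmax_l.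
Qed.

Lemma filterlim_half_aperture (d r c : R) :
  0 < d -> 0 < r ->
  filterlim (fun n : nat => INR n * d / (2 * r) + c) eventually
    (Rbar_locally p_infty).
Proof.
  intros Hd Hr P [K HK].
  assert (Hdr : 0 < d / (2 * r)) by (apply Rdiv_lt_0_compat; lra).
  (* The threshold solves [x * (d / (2 * r)) + c = K] for [x]. *)
  destruct (is_lim_seq_INR (fun x => (K - c) / (d / (2 * r)) < x)) as [N HN];
    [now exists ((K - c) / (d / (2 * r)))|].
  exists N; intros n Hn; apply HK.
  specialize (HN n Hn).
  apply Rlt_div_l in HN; [|exact Hdr].
  unfold Rdiv in *; lra.
Qed.

(** The free shifts [c1] and [c2] let one statement cover all four sign choices of [Phi] and
    [Omega]. *)
Lemma filterlim_U_array (psi d r c1 c2 : R) :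
  0 < psi -> 0 < d -> 0 < r ->
  filterlim
    (fun M : nat * nat =>
       U psi (INR (fst M) * d / (2 * r) + c1) (INR (snd M) * d / (2 * r) + c2))
    (filter_prod eventually eventually) (locally (PI / 2)).
Proof.
  intros Hpsi Hd Hr.
  apply (filterlim_comp_2
           (fun M : nat * nat => INR (fst M) * d / (2 * r) + c1)
           (fun M : nat * nat => INR (snd M) * d / (2 * r) + c2) (U psi))
    with (3 := filterlim_U_p_infty psi Hpsi).
  - apply (filterlim_comp _ _ _ fst (fun n => INR n * d / (2 * r) + c1) _ eventually);
      [apply filterlim_fst | now apply filterlim_half_aperture].
  - apply (filterlim_comp _ _ _ snd (fun n => INR n * d / (2 * r) + c2) _ eventually);
      [apply filterlim_snd | now apply filterlim_half_aperture].
Qed.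

Lemma filterlim_Rplus {T : Type} (F : (T -> Prop) -> Prop) {FF : Filter F}
  (f g : T -> R) (a b : R) :
  filterlim f F (locally a) -> filterlim g F (locally b) ->
  filterlim (fun t => f t + g t) F (locally (a + b)).
Proof.
  intros Hf Hg.
  exact (filterlim_comp_2 f g Rplus Hf Hg (filterlim_plus a b)).
Qed.

Theorem lemma3 (r d P A theta phi : R)
  (hr : 0 < r) (hd : 0 < d) (hP : 0 < P)
  (hA : 0 < A) (hAd : A <= d ^ 2)
  (htheta : 0 < theta < PI) (hphi : - (PI / 2) < phi < PI / 2) :
  filterlim (fun M : nat * nat => gamma A d P r theta phi (fst M) (snd M))
    (filter_prod eventually eventually)
    (locally (occupation_ratio A d * P / 2)).
Proof.
  assert (Hpsi : 0 < Psi theta phi).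
  { apply Rmult_lt_0_compat; [apply sin_gt_0 | apply cos_gt_0]; lra. }
  (* The limit takes the shape of the SNR itself, a constant factor times four limits [PI / 2], so
     that continuity of scaling and the sum rule apply. *)
  replace (occupation_ratio A d * P / 2)
    with (occupation_ratio A d * P / (4 * PI)
          * (PI / 2 + PI / 2 + PI / 2 + PI / 2))
    by (field; apply PI_neq0).
  unfold gamma, closed_form_snr.
  eapply filterlim_comp;
    [|exact (filterlim_scal_r (occupation_ratio A d * P / (4 * PI) : R_AbsRing)
               (PI / 2 + PI / 2 + PI / 2 + PI / 2 : R_NormedModule))].
  (* The differences match the [+ c1] and [+ c2] form because [Rminus] unfolds to adding the
     opposite. *)
  repeat (apply filterlim_Rplus; [exact _ | |]);
    now apply filterlim_U_array.
Qed.
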